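(* Let $G=(V,E)$ be an infinite, locally finite, vertex-transitive graph. Then there exists a non-constant function $f\colon V\to\mathbb{C}$ that is both harmonic and Lipschitz on $G$.
   Context: Graphs are undirected, and $v\sim w$ means that $v$ and $w$ are adjacent. A graph is locally finite if every vertex has finite degree, and vertex-transitive if its automorphism group $\operatorname{Aut}(G)$ acts transitively on the vertex set $V$. For a function $f\colon V\to\mathbb{C}$, define $\nabla f$ on the directed edges of $G$ (ordered pairs $(v,w)$ with $v\sim w$) by $\nabla f(v,w)=f(v)-f(w)$, and define $\Delta f\colon V\to\mathbb{C}$ by $\Delta f(v)=\sum_{w\sim v}(f(v)-f(w))$. The function $f$ is called harmonic if $\Delta f(v)=0$ for all $v\in V$. The function $f$ is called Lipschitz if $\nabla f\in\ell^\infty(E)$, i.e. $\sup_{v\sim w}|f(v)-f(w)|<\infty$. *)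

(* Defs.v *)
From HB Require Import structures.
From mathcomp Require Import all_boot all_order all_algebra.
From mathcomp Require Import all_classical all_reals all_analysis.
From mathcomp Require Import complex.

Set Implicit Arguments.
Unset Strict Implicit.
Unset Printing Implicit Defensive.

Import Order.TTheory GRing.Theory Num.Theory.

Local Open Scope classical_set_scope.
Local Open Scope ring_scope.

(* Loops are not excluded: they contribute nothing to [nabla] or [laplacian].
   Connectedness is not assumed either. *)
Record graph (V : choiceType) := Graph {
  adj : V -> V -> Prop;
  adj_sym : forall v w, adj v w -> adj w v }.

Section Graphs.
Variables (V : choiceType) (G : graph V).

Definition neighbors (v : V) : set V := [set w | adj G v w].

Definition directed_edges : set (V * V) := [set e | adj G e.1 e.2].

Definition locally_finite : Prop := forall v, finite_set (neighbors v).

Definition automorphism (phi : V -> V) : Prop :=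
  bijective phi /\ forall v w, adj G (phi v) (phi w) <-> adj G v w.

Definition vertex_transitive : Prop :=
  forall v w, exists2 phi, automorphism phi & phi v = w.

End Graphs.

Section Functions.
Variables (R : realType) (V : choiceType) (G : graph V).
Implicit Type f : V -> R[i].

Definition nabla f (e : V * V) : R[i] := f e.1 - f e.2.

(* The sum over a set is the sum over the finite support of the summand, so
   this is the Laplacian as soon as G is locally finite; it would be 0 by
   convention at a vertex where infinitely many terms are nonzero. *)
Definition laplacian f (v : V) : R[i] :=
  \sum_(w \in neighbors G v) (f v - f w).

Definition graph_harmonic f : Prop := forall v, laplacian f v = 0.

(* The norm of R[i] takes its (real) values in R[i]; [complex.Re] brings the
   modulus back to R. *)
Definition graph_Lipschitz f : Prop :=
  has_ubound [set complex.Re `|nabla f e| | e in directed_edges G].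

End Functions.

(* Main.v *)
(** Let [P] be the lazy simple random walk and [p_n(x, .)] its heat kernel.  A
function [F = P^n g] moves little under [P] when [p_n - p_{n+1}] is small, and a
limit of such functions, normalised to have gradient of order 1 near a root
[o], is the harmonic function sought.  There are two sources of [g].

- If the Dirichlet energies [E_n = <p_n, (1 - P) p_n>] do not decay
  exponentially, then [||p_n - p_{n+1}||^2 <= eps E_n] for some [n], and one
  takes [g = p_n(o, .) - p_n(x, .)] for a neighbour [x] of [o]: by
  Cauchy-Schwarz and transitivity the gradient of [P^n g] is largest, up to a
  constant, at [(o, x)].
- If they do, then so do the return probabilities [a_n].  By Jensen the entropy
  [H_n] of [p_n(o, .)] is at least [- ln a_{2n}], so it grows linearly, while
  [H_{n+1} - H_n] is bounded by the l^1 distances between [p_n(x, .)] and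
  [p_{n+1}(o, .)] for [x] equal or adjacent to [o].  So these do not tend to 0,
  and one takes for [g] the sign of [p_n(x, .) - p_{n+1}(o, .)]. *)
Require Import Defs.
From mathcomp Require Import all_boot all_order all_algebra.
From mathcomp Require Import all_classical all_reals all_analysis.
From mathcomp Require Import complex.
From mathcomp Require Import finmap ring lra.

Set Implicit Arguments.
Unset Strict Implicit.
Unset Printing Implicit Defensive.

Import Order.TTheory GRing.Theory Num.Theory.
Import numFieldNormedType.Exports.

Local Open Scope classical_set_scope.
Local Open Scope ring_scope.

Section RegularGraph.
Variables (R : realType) (V : choiceType) (nbrs : V -> seq V) (d : nat).
Hypothesis d_gt0 : (0 < d)%N.
Hypothesis nbrs_uniq : forall v, uniq (nbrs v).
Hypothesis nbrs_sym : forall v w, (w \in nbrs v) = (v \in nbrs w).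
Hypothesis size_nbrs : forall v, size (nbrs v) = d.
Implicit Types (f g : V -> R) (u v w x y z : V) (s B : seq V).

Let dR_gt0 : 0 < d%:R :> R. Proof. by rewrite ltr0n. Qed.
Let dR_neq0 : d%:R != 0 :> R. Proof. by rewrite pnatr_eq0 -lt0n. Qed.
Let dR_ge1 : 1 <= d%:R :> R. Proof. by rewrite ler1n. Qed.

(** ** Lazy random walk and heat kernel *)

(** A list with possible repetitions, hence the [undup] in later sums; it contains the support of
    [heat n x]. *)
Fixpoint ball n x : seq V :=
  if n is m.+1 then flatten [seq v :: nbrs v | v <- ball m x] else [:: x].

Lemma ballS n x v w : v \in ball n x -> w \in v :: nbrs v -> w \in ball n.+1 x.
Proof. by move=> vb wv; apply/flatten_mapP; exists v. Qed.

Lemma ball_le n m x : (n <= m)%N -> {subset ball n x <= ball m x}.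
Proof.
elim: m => [|m IH]; first by rewrite leqn0 => /eqP ->.
rewrite leq_eqVlt => /predU1P[->//|/IH nm] y /nm yb.
by apply: ballS yb _; rewrite mem_head.
Qed.

Definition avg f v := (\sum_(w <- nbrs v) f w) / d%:R.
Definition walk f v := (f v + avg f v) / 2.

Lemma avg_cst (c : R) v : avg (fun=> c) v = c.
Proof.
rewrite /avg big_const_seq count_predT size_nbrs iter_addr_0.
by rewrite -(mulr_natr c) mulfK.
Qed.

Lemma avg_le f g v : {in nbrs v, forall w, f w <= g w} -> avg f v <= avg g v.
Proof.
move=> fg; rewrite ler_wpM2r ?invr_ge0 ?ler0n//.
by rewrite big_seq_cond [leRHS]big_seq_cond ler_sum// => w /andP[/fg].
Qed.

Lemma walk_cst (c : R) v : walk (fun=> c) v = c.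
Proof. by rewrite /walk avg_cst; field. Qed.

Lemma walk_le f g v : {in v :: nbrs v, forall w, f w <= g w} ->
  walk f v <= walk g v.
Proof.
move=> fg; rewrite ler_wpM2r ?invr_ge0 ?ler0n// lerD ?fg ?mem_head//.
by apply: avg_le => w wv; rewrite fg// inE wv orbT.
Qed.

Lemma walk_eq f g v : {in v :: nbrs v, f =1 g} -> walk f v = walk g v.
Proof. by move=> fg; apply/le_anti; rewrite !walk_le// => w /fg ->. Qed.

Lemma walk_lin (c : R) f g v :
  walk (fun x => c * f x + g x) v = c * walk f v + walk g v.
Proof. by rewrite /walk /avg big_split/= -mulr_sumr; field. Qed.

Lemma iter_walkS n f v : iter n.+1 walk f v = iter n walk (walk f) v.
Proof. by rewrite iterSr. Qed.

Lemma iter_walk_lin n (c : R) f g v :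
  iter n walk (fun x => c * f x + g x) v =
  c * iter n walk f v + iter n walk g v.
Proof.
elim: n v => //= n IH v; rewrite -walk_lin.
by congr walk; apply/funext => w; exact: IH.
Qed.

Lemma iter_walk_cst n (c : R) v : iter n walk (fun=> c) v = c.
Proof.
elim: n v => //= n IH v; rewrite -[RHS](walk_cst c v).
by congr walk; apply/funext => w; exact: IH.
Qed.

Lemma iter_walkB n f g v :
  iter n walk (fun x => f x - g x) v = iter n walk f v - iter n walk g v.
Proof.
have -> : (fun x => f x - g x) = (fun x => (- 1) * g x + f x).
  by apply/funext => x; ring.
by rewrite iter_walk_lin; ring.
Qed.

Lemma iter_walk_sum n s (c : V -> R) (F : V -> V -> R) v :
  iter n walk (fun x => \sum_(y <- s) c y * F y x) v =
  \sum_(y <- s) c y * iter n walk (F y) v.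
Proof.
elim: s => [|y s IH].
  rewrite big_nil -[RHS](iter_walk_cst n 0 v); congr (iter _ _ _ _).
  by apply/funext => x; rewrite big_nil.
rewrite big_cons -IH -iter_walk_lin; congr (iter _ _ _ _).
by apply/funext => x; rewrite big_cons.
Qed.

Lemma iter_walk_le n f g v : (forall w, f w <= g w) ->
  iter n walk f v <= iter n walk g v.
Proof. by move=> fg; elim: n v => //= n IH v; apply: walk_le => w _. Qed.

Lemma iter_walk_norm n (c : R) f v : (forall w, `|f w| <= c) ->
  `|iter n walk f v| <= c.
Proof.
move=> fc; rewrite ler_norml -{1}(iter_walk_cst n (- c) v).
rewrite -{2}(iter_walk_cst n c v) !iter_walk_le// => w;
  by have := fc w; rewrite ler_norml => /andP[].
Qed.

Lemma iter_walk_local n f g v : {in ball n v, f =1 g} ->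
  iter n walk f v = iter n walk g v.
Proof.
elim: n f g => [f g fg|n IH f g fg]; first exact/fg/mem_head.
rewrite !iter_walkS; apply: IH => w wb; apply: walk_eq => z zw.
by apply: fg; exact: ballS wb zw.
Qed.

Definition delta x y : R := (x == y)%:R.
(** By definition [P^n] applied to the point mass at [x]; [heat_sym] identifies it with the law at
    time [n] of the walk started at [x]. *)
Definition heat n x : V -> R := iter n walk (delta x).

Lemma walk_delta x :
  walk (delta x) =
  fun y => 2^-1 * delta x y + \sum_(w <- nbrs x) (d%:R^-1 / 2) * delta w y.
Proof.
apply/funext => y; rewrite /walk /avg /delta mulrDl mulrC; congr (_ + _).
rewrite -mulr_sumr [in RHS]mulrC -mulrA; congr (_ * _).
have sumE z s : uniq s -> \sum_(w <- s) (z == w)%:R = (z \in s)%:R :> R.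
  elim: s => [|a s IH]; first by rewrite big_nil.
  rewrite big_cons inE => /= /andP[/negbTE as_ /IH ->].
  by case: (eqVneq z a) => [->|_]; rewrite ?as_ ?addr0 ?add0r.
under [in RHS]eq_bigr do rewrite eq_sym.
by rewrite !sumE// nbrs_sym.
Qed.

(** Induction peeling off the last application of [walk] on one side and the first on the other. The
    two recursions agree by [walk_delta], where the symmetry of adjacency enters. *)
Lemma heat_sym n x y : heat n x y = heat n y x.
Proof.
elim: n x y => [|n IH] x y; first by rewrite /heat/= /delta eq_sym.
rewrite {2}/heat iter_walkS walk_delta iter_walk_lin iter_walk_sum.
rewrite /heat/= {1}/walk /avg -mulr_sumr.
rewrite -!/(heat _ _ _) [heat n x y]IH.
under eq_bigr do rewrite -/(heat _ _ _) IH.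
by rewrite mulrDl mulrC; congr (_ + _); rewrite -mulrA mulrC.
Qed.

Lemma heat_ge0 n x y : 0 <= heat n x y.
Proof.
rewrite -(iter_walk_cst n 0 y); apply: iter_walk_le => w.
by rewrite ler0n.
Qed.

Lemma heatS n x y : heat n.+1 x y = walk (fun z => heat n z y) x.
Proof.
rewrite heat_sym /heat/=; congr walk; apply/funext => z.
by rewrite -!/(heat _ _ _) heat_sym.
Qed.

(* Stands for the sum over [V], whose other terms vanish. *)
Lemma sum_heat n x f B : uniq B -> {subset ball n x <= B} ->
  \sum_(y <- B) heat n x y * f y = iter n walk f x.
Proof.
move=> uB sB.
have -> : iter n walk f x =
    iter n walk (fun z => \sum_(y <- B) f y * delta y z) x.
  apply: iter_walk_local => z /sB zB.
  rewrite (bigD1_seq z)//= /delta eqxx mulr1 big1 ?addr0// => y yz.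
  by rewrite (negbTE yz) mulr0.
rewrite iter_walk_sum; apply: eq_bigr => y _.
by rewrite heat_sym mulrC.
Qed.

Lemma sum_heat1 n x B : uniq B -> {subset ball n x <= B} ->
  \sum_(y <- B) heat n x y = 1.
Proof.
move=> uB sB; rewrite -[RHS](iter_walk_cst n 1 x) -(sum_heat _ uB sB).
by apply: eq_bigr => y _; rewrite mulr1.
Qed.

(** The Chapman-Kolmogorov identity; [B] only has to contain the ball of the first factor. *)
Lemma sum_heatM n m x z B : uniq B -> {subset ball n x <= B} ->
  \sum_(y <- B) heat n x y * heat m z y = heat (n + m) x z.
Proof.
by move=> uB sB; rewrite sum_heat// [RHS]heat_sym /heat iterD.
Qed.

Lemma heat_out n x y : y \notin ball n x -> heat n x y = 0.
Proof.
move=> yb; rewrite heat_sym /heat -(iter_walk_cst n 0 x).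
apply: iter_walk_local => z zb; rewrite /delta.
by case: eqVneq => // yz; rewrite yz zb in yb.
Qed.

Lemma heat_diag_gt0 n x : 0 < heat n x x.
Proof.
elim: n => [|n IH]; first by rewrite /heat/= /delta eqxx.
rewrite /heat/= /walk -!/(heat _ _) divr_gt0// ltr_wpDr// /avg.
by rewrite divr_ge0 ?ler0n ?sumr_ge0// => w _; rewrite heat_ge0.
Qed.

(** A step from [x] goes to [w] with probability at least [1 / (2 * d)]. *)
Lemma le_heatS n x w y : w \in x :: nbrs x ->
  heat n w y <= (2 * d%:R) * heat n.+1 x y.
Proof.
move=> wx; rewrite heatS /walk /avg.
have S_ge0 : 0 <= \sum_(z <- nbrs x) heat n z y.
  by rewrite sumr_ge0// => z _; rewrite heat_ge0.
have -> : 2 * d%:R * ((heat n x y + (\sum_(z <- nbrs x) heat n z y) / d%:R) / 2)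
   = d%:R * heat n x y + \sum_(z <- nbrs x) heat n z y.
  by field.
move: wx; rewrite inE => /predU1P[->|wx].
  by rewrite ler_wpDr// ler_peMl// heat_ge0.
rewrite ler_wpDl ?mulr_ge0 ?heat_ge0 ?ler0n//.
rewrite (bigD1_seq w)//= lerDl sumr_ge0// => z _; exact: heat_ge0.
Qed.

(** ** Total variation of one step *)

(** One-sided, because [g] may be replaced by [- g]. The supremum over such [g] is the l^1 distance
    between consecutive heat kernels. *)
Let tv_bound (t : R) l := forall g v, (forall w, `|g w| <= 1) ->
  iter l walk g v - iter l.+1 walk g v <= t.

(** The [k] extra steps turn [g] into another function bounded by 1. *)
Let tv_bound_add t l k : tv_bound t l -> tv_bound t (k + l).
Proof.
move=> tl g v g1; rewrite addnC -addSn !iterD; apply: tl => w.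
exact: iter_walk_norm.
Qed.

(** [K] and [eta] can be chosen from [eps] alone, so that finitely many rounds bring the bound from
    2 down to [eps]. *)
Let tv_bound_improve (eps t eta : R) l K : 0 < eps -> eps <= t ->
  2 < K.+1%:R * (eps / 2) -> eta * 2 ^+ K <= eps / 2 ->
  tv_bound t l -> tv_bound (t - eta) (K + l).
Proof.
move=> eps0 epst K2 etaK tl g v g1; rewrite leNgt; apply/negP => Hlt.
pose w j u := iter (j + l) walk g u - iter (j + l).+1 walk g u.
have w_le j u : w j u <= t by apply: (tv_bound_add j tl).
have wS j : w j.+1 v <= (w j v + t) / 2.
  rewrite /w addSn /= -/(iter (j + l).+1 walk g) /=.
  have -> : walk (iter (j + l) walk g) v - walk (walk (iter (j + l) walk g)) v
          = walk (w j) v.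
    have -> : w j = fun x =>
        - 1 * iter (j + l).+1 walk g x + iter (j + l) walk g x.
      by apply/funext => x; rewrite /w; ring.
    by rewrite walk_lin /=; ring.
  by rewrite /walk ler_pM2r ?invr_gt0// lerD2l -(avg_cst t v) avg_le// => u _.
(* Backwards in time, the deficit of [w] below [t] at most doubles at each step. *)
have w_ge i : (i <= K)%N -> t - eta * 2 ^+ i <= w (K - i)%N v.
  elim: i => [|i IH] iK; first by rewrite subn0 expr0 mulr1 ltW.
  have := IH (ltnW iK); have -> : (K - i)%N = (K - i.+1).+1 by rewrite -subSn.
  by have := wS (K - i.+1)%N; rewrite exprS; lra.
have w_half j : (j <= K)%N -> eps / 2 <= w j v.
  move=> jK; have := w_ge (K - j)%N (leq_subr _ _); rewrite subKn//.
  have eta_ge0 : 0 <= eta by have := w_le K v; rewrite /w; lra.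
  have : eta * 2 ^+ (K - j) <= eta * 2 ^+ K.
    by rewrite ler_wpM2l// ler_weXn2l ?leq_subr// ler1n.
  lra.
have : \sum_(j < K.+1) w j v >= \sum_(j < K.+1) (eps / 2).
  by apply: ler_sum => j _; apply: w_half; rewrite -ltnS.
rewrite sumr_const card_ord -mulr_natl.
have -> : \sum_(j < K.+1) w j v = iter l walk g v - iter (K.+1 + l) walk g v.
  elim: K.+1 => [|k IH]; first by rewrite big_ord0 add0n subrr.
  by rewrite big_ord_recr IH /w addSn /=; ring.
have /ler_normlW := iter_walk_norm l v g1.
have : - 1 <= iter (K.+1 + l) walk g v.
  by have := iter_walk_norm (K.+1 + l) v g1; rewrite ler_norml => /andP[].
lra.
Qed.

(* If the one-step difference is at most [t] from time [l] on and almost [t] at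
   a vertex at time [l + K], then laziness forces it to be almost [t] at this
   vertex at all the times in between; these differences telescope to at most
   2, which is absurd for large [K]. *)
Lemma iter_walk_step (eps : R) : 0 < eps -> exists l0, forall l g v,
  (l0 <= l)%N -> (forall w, `|g w| <= 1) ->
  `|iter l walk g v - iter l.+1 walk g v| <= eps.
Proof.
move=> eps0; pose K := Num.bound (4 / eps).
have K2 : 2 < K.+1%:R * (eps / 2).
  have /archi_boundP : 0 <= 4 / eps by rewrite divr_ge0// ltW.
  rewrite -/K ltr_pdivrMr// -[K.+1]addn1 natrD; nra.
have p2 : 0 < 2 ^+ K :> R by rewrite exprn_gt0.
pose eta := eps / 2 / 2 ^+ K.
have etaK : eta * 2 ^+ K <= eps / 2 by rewrite /eta divfK// gt_eqF.
have eta0 : 0 < eta by rewrite !divr_gt0.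
have bound m : exists l, tv_bound (Num.max eps (2 - m%:R * eta)) l.
  elim: m => [|m [l tl]].
    exists 0 => g v g1; rewrite mul0r subr0 le_max; apply/orP; right => /=.
    have := g1 v; have := iter_walk_norm 1 v g1; rewrite /= !ler_norml; lra.
  exists (K + l)%N => g v g1.
  have et : eps <= Num.max eps (2 - m%:R * eta) by rewrite le_max lexx.
  apply: le_trans (tv_bound_improve eps0 et K2 etaK tl v g1) _.
  rewrite -natr1 lerBlDr ge_max.
  apply/andP; split; rewrite -lerBlDr le_max; apply/orP; [left|right]; lra.
pose m := Num.bound (2 / eta).
have [l0 tl0] := bound m.
have m2 : Num.max eps (2 - m%:R * eta) <= eps.
  have /archi_boundP : 0 <= 2 / eta by rewrite divr_ge0// ltW.
  by rewrite -/m ltr_pdivrMr// => ?; rewrite ge_max lexx /=; lra.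
exists l0 => l g v l0l g1; rewrite -(subnK l0l) ler_norml.
apply/andP; split; last exact: le_trans (tv_bound_add _ tl0 _ g1) m2.
(* The lower bound is the upper bound for [- g], in the form that [iter_walk_lin] accepts. *)
have gN1 w : `|- 1 * g w + 0| <= 1 by rewrite addr0 mulN1r normrN.
have := le_trans (tv_bound_add (l - l0) tl0 v gN1) m2.
by rewrite !iter_walk_lin !iter_walk_cst; lra.
Qed.

(** ** Energy of the heat kernel *)

(** Lagrange's identity: twice the defect is a double sum of squares. *)
Lemma sum_CauchySchwarz B f g :
  (\sum_(y <- B) f y * g y) ^+ 2 <=
  (\sum_(y <- B) f y ^+ 2) * (\sum_(y <- B) g y ^+ 2).
Proof.
pose S := \sum_(x <- B) \sum_(y <- B) (f x * g y - f y * g x) ^+ 2.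
have S_ge0 : 0 <= S.
  by rewrite sumr_ge0// => x _; rewrite sumr_ge0// => y _; rewrite sqr_ge0.
suff SE : S = 2 * ((\sum_(y <- B) f y ^+ 2) * (\sum_(y <- B) g y ^+ 2)
                   - (\sum_(y <- B) f y * g y) ^+ 2) by lra.
rewrite expr2 !big_distrlr/=.
set T := \sum_(x <- B) \sum_(y <- B) _; set U := \sum_(x <- B) \sum_(y <- B) _.
have ET : \sum_(x <- B) \sum_(y <- B) f y ^+ 2 * g x ^+ 2 = T.
  by rewrite exchange_big.
rewrite mulrBr -[2 * T]/((1 + 1) * T) mulrDl mul1r -{2}ET mulr_sumr.
rewrite -big_split -sumrB/=; apply: eq_bigr => x _.
rewrite mulr_sumr -big_split -sumrB/=; apply: eq_bigr => y _; ring.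
Qed.

(** Double counting: each [f w] occurs once for every neighbour of [w] in [B], hence at most [d]
    times. *)
Lemma sum_avg_le f B : uniq B -> (forall y, 0 <= f y) ->
  (forall y, y \notin B -> f y = 0) ->
  \sum_(y <- B) avg f y <= \sum_(y <- B) f y.
Proof.
move=> uB f0 fB; rewrite -mulr_suml ler_pdivrMr// mulr_suml.
have -> : \sum_(y <- B) \sum_(w <- nbrs y) f w =
          \sum_(y <- B) \sum_(w <- B | w \in nbrs y) f w.
  apply: eq_bigr => y _.
  rewrite (bigID (mem B))/= [X in _ + X]big1 ?addr0; last by move=> w /fB.
  rewrite -big_filter -[RHS]big_filter; apply/perm_big/uniq_perm.
  - exact: filter_uniq.
  - exact: filter_uniq.
  - by move=> w; rewrite !mem_filter andbC.
rewrite (exchange_big_dep xpredT)//=; apply: ler_sum => w _.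
rewrite big_const_seq iter_addr_0 -(mulr_natr (f w)) ler_wpM2l// ler_nat.
rewrite -size_filter -(size_nbrs w) uniq_leq_size ?filter_uniq// => y.
by rewrite mem_filter nbrs_sym => /andP[].
Qed.

(* Where the laziness of the walk is used: [2 walk = 1 + avg], and [avg] is a
   contraction of l^2. *)
Lemma walk_nonneg f B : uniq B -> (forall y, y \notin B -> f y = 0) ->
  0 <= \sum_(y <- B) f y * walk f y.
Proof.
move=> uB fB; pose h y := f y ^+ 2.
have h_avg : \sum_(y <- B) avg h y <= \sum_(y <- B) h y.
  apply: sum_avg_le => // y; first exact: sqr_ge0.
  by move=> /fB; rewrite /h => ->; rewrite expr0n.
(* This is [(f y + f w) ^+ 2 >= 0] averaged over the neighbours [w] of [y]. *)
have key y : h y - avg h y <= 4 * (f y * walk f y).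
  suff : - (h y + avg h y) <= 2 * f y * avg f y by rewrite /walk /h; lra.
  rewrite /avg -(avg_cst (h y) y) /avg -mulrDl -big_split/= -mulNr -sumrN.
  rewrite mulrA mulr_sumr ler_wpM2r ?invr_ge0 ?ler0n// ler_sum// => w _.
  by have := sqr_ge0 (f y + f w); rewrite /h; lra.
have : \sum_(y <- B) (h y - avg h y) <= \sum_(y <- B) 4 * (f y * walk f y).
  exact: ler_sum.
by rewrite sumrB -mulr_sumr; lra.
Qed.

(** * Vertex-transitivity: return probabilities and energies do not depend on the vertex *)

Hypothesis nbrs_trans : forall v w, exists phi : V -> V,
  [/\ injective phi, phi v = w &
      forall u, perm_eq (map phi (nbrs u)) (nbrs (phi u))].

Lemma iter_walk_aut (phi : V -> V) n f u :
  (forall u, perm_eq (map phi (nbrs u)) (nbrs (phi u))) ->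
  iter n walk (f \o phi) u = iter n walk f (phi u).
Proof.
move=> aut; elim: n u => //= n IH u.
rewrite /walk IH; congr ((_ + _) / _); rewrite /avg; congr (_ / _).
by rewrite -(perm_big _ (aut u)) big_map; apply: eq_bigr => w _; rewrite IH.
Qed.

Lemma heat_aut (phi : V -> V) n x y : injective phi ->
  (forall u, perm_eq (map phi (nbrs u)) (nbrs (phi u))) ->
  heat n (phi x) (phi y) = heat n x y.
Proof.
move=> inj aut; rewrite /heat -iter_walk_aut//; congr (iter _ _ _ _).
by apply/funext => z; rewrite /delta/= inj_eq.
Qed.

Variable o : V.

Definition return_prob n : R := heat n o o.

Lemma heat_diag n x : heat n x x = return_prob n.
Proof. by have [phi [inj <- aut]] := nbrs_trans o x; rewrite heat_aut. Qed.

(* The squared l^2 distance between [heat n x] and [heat n z], by [dist2E]. *)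
Definition dist2 n x z : R := 2 * (return_prob (n + n) - heat (n + n) x z).

Lemma dist2E n x z B : uniq B ->
  {subset ball n x <= B} -> {subset ball n z <= B} ->
  \sum_(y <- B) (heat n x y - heat n z y) ^+ 2 = dist2 n x z.
Proof.
move=> uB xB zB.
have -> : dist2 n x z =
    (heat (n + n) x x - heat (n + n) x z) -
    (heat (n + n) z x - heat (n + n) z z).
  by rewrite /dist2 !heat_diag (heat_sym _ z x); ring.
rewrite -!(sum_heatM n _ uB xB) -!(sum_heatM n _ uB zB) -!sumrB.
by apply: eq_bigr => y _; ring.
Qed.

(** The Dirichlet energy [<p_n, (1 - P) p_n>], expressed by return probabilities through
    Chapman-Kolmogorov. *)
Definition energy n : R := return_prob (n + n) - return_prob (n + n).+1.

Lemma heat_ball n x B y :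
  {subset ball n x <= B} -> y \notin B -> heat n x y = 0.
Proof. by move=> xB yB; apply: heat_out; apply: contra yB => /xB. Qed.

(* The squared l^2 norm of [heat n x - heat n.+1 x], by [energy_dropE]. *)
Definition energy_drop n : R :=
  energy n - (return_prob (n + n).+1 - return_prob (n + n).+2).

Lemma energy_dropE n x B : uniq B -> {subset ball n.+1 x <= B} ->
  \sum_(y <- B) (heat n x y - heat n.+1 x y) ^+ 2 = energy_drop n.
Proof.
move=> uB x1B; have xB : {subset ball n x <= B}.
  by move=> y /(ball_le (leqnSn n))/x1B.
have -> : energy_drop n =
    (heat (n + n) x x - heat (n + n.+1) x x) -
    (heat (n.+1 + n) x x - heat (n.+1 + n.+1) x x).
  by rewrite !heat_diag !addSn !addnS /energy_drop /energy; ring.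
rewrite -(sum_heatM n _ uB xB) -(sum_heatM n.+1 _ uB xB).
rewrite -(sum_heatM n _ uB x1B) -(sum_heatM n.+1 _ uB x1B) -!sumrB.
by apply: eq_bigr => y _; ring.
Qed.

(** The difference of the two sides is [<g, P g>] for [g = p_n - p_{n+1}], nonnegative by
    [walk_nonneg]. *)
Lemma energy_dropP n : energy_drop n <= energy n - energy n.+1.
Proof.
pose B := undup (ball n.+1 o).
have uB : uniq B by exact: undup_uniq.
have B1 : {subset ball n.+1 o <= B} by move=> y; rewrite mem_undup.
have B0 : {subset ball n o <= B} by move=> y /(ball_le (leqnSn n))/B1.
pose g y := - 1 * heat n.+1 o y + heat n o y.
have gB y : y \notin B -> g y = 0.
  by move=> yB; rewrite /g !(heat_ball _ yB)// mulr0 addr0.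
have := walk_nonneg uB gB.
have -> : walk g = fun y => - 1 * heat n.+2 o y + heat n.+1 o y.
  by apply/funext => y; rewrite walk_lin.
have -> : \sum_(y <- B) g y * (- 1 * heat n.+2 o y + heat n.+1 o y) =
  (heat (n.+1 + n.+2) o o - heat (n.+1 + n.+1) o o) -
  (heat (n + n.+2) o o - heat (n + n.+1) o o).
  rewrite -(sum_heatM n.+1 _ uB B0) -(sum_heatM n.+2 _ uB B0).
  rewrite -(sum_heatM n.+2 _ uB B1) -(sum_heatM n.+1 _ uB B1) -!sumrB.
  by apply: eq_bigr => y _; rewrite /g; ring.
by rewrite -!/(return_prob _) /energy_drop /energy !addSn !addnS; lra.
Qed.

Lemma energy_drop_ge0 n : 0 <= energy_drop n.
Proof.
rewrite -(@energy_dropE n o (undup (ball n.+1 o))) ?undup_uniq//; last first.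
  by move=> y; rewrite mem_undup.
by rewrite sumr_ge0// => y _; rewrite sqr_ge0.
Qed.

Lemma dist2_ge0 n x z : 0 <= dist2 n x z.
Proof.
pose B := undup (ball n x ++ ball n z).
rewrite -(@dist2E n x z B) ?undup_uniq//; last 2 first.
- by move=> y yx; rewrite mem_undup mem_cat yx.
- by move=> y yz; rewrite mem_undup mem_cat yz orbT.
by rewrite sumr_ge0// => y _; rewrite sqr_ge0.
Qed.

(** Since the terms are nonnegative, none exceeds [d] times this mean, and some term reaches it;
    this is what makes the gradient comparable at all edges. *)
Lemma avg_dist2 n x : avg (dist2 n x) x = 4 * energy n.
Proof.
have -> : dist2 n x = fun z => - 2 * heat (n + n) x z + 2 * return_prob (n + n).
  by apply/funext => z; rewrite /dist2; ring.
have := walk_lin (- 2) (heat (n + n) x) (fun=> 2 * return_prob (n + n)) x.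
rewrite walk_cst -[walk (heat _ _)]/(heat (n + n).+1 x) heat_diag.
rewrite /walk heat_diag /energy; lra.
Qed.

Lemma dist2_le n x z : z \in nbrs x -> dist2 n x z <= 4 * d%:R * energy n.
Proof.
move=> zx; have := avg_dist2 n x; rewrite /avg => /(canRL (divfK dR_neq0)) e4.
rewrite mulrAC -e4 (bigD1_seq z)//= lerDl sumr_ge0// => w _; exact: dist2_ge0.
Qed.

Lemma dist2_ge n : exists2 x, x \in nbrs o & 4 * energy n <= dist2 n o x.
Proof.
apply: contrapT => H; have : avg (dist2 n o) o < avg (fun=> 4 * energy n) o.
  rewrite /avg ltr_pM2r ?invr_gt0// big_seq [ltRHS]big_seq ltr_sum//.
    have := d_gt0; rewrite -(size_nbrs o).
    by case: (nbrs o) => //= v s _; rewrite mem_head.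
  by move=> w wo; rewrite ltNge; apply/negP => le4; apply: H; exists w.
by rewrite avg_cst avg_dist2 ltxx.
Qed.

(* [A] is a normalisation; the point is to have [c] independent of [eps]. *)
Definition almost_harmonic (eps c : R) f := exists2 A : R, 0 < A &
  [/\ forall x z, z \in nbrs x -> (f x - f z) ^+ 2 <= A,
      forall x, (f x - walk f x) ^+ 2 <= eps * A &
      exists2 x, x \in nbrs o & c * A <= (f x - f o) ^+ 2].

(** Every difference of values of [f] is a scalar product with [g], bounded by Cauchy-Schwarz. At
    the edge [(o, x0)] the other factor is [g] itself up to sign, so the difference is exactly
    [- N]; whence the lower bound. *)
Lemma almost_harmonic_energy (eps : R) n : 0 < eps -> 0 < energy n ->
  energy_drop n <= eps * energy n ->
  exists f, almost_harmonic eps d%:R^-1 f.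
Proof.
move=> eps0 E0 dropE; have [x0 x0o N_ge] := dist2_ge n.
have N0 : 0 < dist2 n o x0 := lt_le_trans (mulr_gt0 (ltr0n _ 4) E0) N_ge.
set N := dist2 n o x0 in N_ge N0 *.
pose g y := heat n o y - heat n x0 y; pose f := iter n walk g.
have CS (a b : V -> R) B x z : uniq B ->
    {subset ball n o <= B} -> {subset ball n x0 <= B} ->
    f x = \sum_(y <- B) a y * g y -> walk f z = \sum_(y <- B) b y * g y ->
    (f x - walk f z) ^+ 2 <= (\sum_(y <- B) (a y - b y) ^+ 2) * N.
  move=> uB oB x0B -> ->; rewrite /N -(dist2E uB oB x0B) -sumrB.
  apply: le_trans (sum_CauchySchwarz _ _ _); rewrite le_eqVlt; apply/orP; left.
  by apply/eqP; congr (_ ^+ 2); apply: eq_bigr => y _; rewrite mulrBl.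
exists f, (4 * d%:R * energy n * N).
  by apply: mulr_gt0 N0; rewrite !mulr_gt0.
split=> [x z zx|x|].
- pose B := undup (ball n x ++ ball n z ++ ball n o ++ ball n x0).
  have uB : uniq B by exact: undup_uniq.
  have [xB zB oB x0B] : [/\ {subset ball n x <= B}, {subset ball n z <= B},
      {subset ball n o <= B} & {subset ball n x0 <= B}].
    by split=> y yb; rewrite mem_undup !mem_cat yb ?orbT.
  have -> : f x - f z = \sum_(y <- B) (heat n x y - heat n z y) * g y.
    rewrite /f -(sum_heat _ uB xB) -(sum_heat _ uB zB) -sumrB.
    by apply: eq_bigr => y _; rewrite mulrBl.
  apply: le_trans (sum_CauchySchwarz _ _ _) _.
  by rewrite (dist2E uB xB zB) (dist2E uB oB x0B) ler_wpM2r ?dist2_le// ltW.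
- pose B := undup (ball n.+1 x ++ ball n o ++ ball n x0).
  have uB : uniq B by exact: undup_uniq.
  have [xB oB x0B] : [/\ {subset ball n.+1 x <= B},
      {subset ball n o <= B} & {subset ball n x0 <= B}].
    by split=> y yb; rewrite mem_undup !mem_cat yb ?orbT.
  apply: le_trans (CS (heat n x) (heat n.+1 x) B _ _ uB oB x0B _ _) _.
  + by rewrite sum_heat// => y /(ball_le (leqnSn n))/xB.
  + by rewrite sum_heat.
  rewrite energy_dropE// mulrA ler_wpM2r ?(ltW N0)//.
  rewrite (le_trans dropE)// ler_wpM2l ?(ltW eps0)//.
  by rewrite -[leLHS]mul1r ler_wpM2r ?(ltW E0)//; move: dR_ge1; lra.
exists x0 => //.
have -> : d%:R^-1 * (4 * d%:R * energy n * N) = 4 * energy n * N by field.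
pose B := undup (ball n o ++ ball n x0).
have uB : uniq B by exact: undup_uniq.
have [oB x0B] : {subset ball n o <= B} /\ {subset ball n x0 <= B}.
  by split=> y yb; rewrite mem_undup !mem_cat yb ?orbT.
have -> : f x0 - f o = - N.
  rewrite /f -(sum_heat _ uB oB) -(sum_heat _ uB x0B) /N -(dist2E uB oB x0B).
  by rewrite -sumrB -sumrN; apply: eq_bigr => y _; rewrite /g; ring.
by rewrite sqrrN expr2 ler_wpM2r// ltW.
Qed.

Hypothesis connected : forall x, exists n, x \in ball n o.
Hypothesis V_infinite : forall n, exists2 s : seq V, uniq s & size s = n.

Lemma ball_lipschitz n x f (c : R) : 0 <= c ->
  (forall u w, w \in nbrs u -> `|f u - f w| <= c) ->
  x \in ball n o -> `|f x - f o| <= n%:R * c.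
Proof.
move=> c0 fc; elim: n x => [|n IH] x.
  by rewrite inE => /eqP ->; rewrite subrr normr0 mul0r.
move=> /flatten_mapP[v /IH vo]; rewrite inE -natr1 mulrDl mul1r.
move=> /predU1P[->|xv]; first by rewrite ler_wpDr.
rewrite (le_trans (ler_distD (f v) _ _))// addrC lerD// distrC.
exact: fc.
Qed.

(** * Exponential decay of energies and return probabilities *)

Section EnergyDecay.
Variable eps : R.
Hypotheses (eps_gt0 : 0 < eps) (eps_lt1 : eps < 1).
Hypothesis dropE : forall n, eps * energy n <= energy_drop n.

Let rho : R := 1 - eps.
Let rho_gt0 : 0 < rho. Proof. by rewrite subr_gt0. Qed.
Let rho_lt1 : rho < 1. Proof. by rewrite gtrBl. Qed.

Let energy_decay n : energy n <= rho ^+ n.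
Proof.
elim: n => [|n IH].
  have r0 : return_prob 0 = 1 by rewrite /return_prob /heat/= /delta eqxx.
  have : 0 <= return_prob 1 by exact: heat_ge0.
  rewrite expr0 /energy add0n r0; lra.
rewrite exprS (le_trans _ (ler_wpM2l (ltW rho_gt0) IH))//.
by have := dropE n; have := energy_dropP n; rewrite /rho; lra.
Qed.

Let exp_small (dlt : R) : 0 < dlt ->
  exists n0, forall n, (n0 <= n)%N -> rho ^+ n <= dlt.
Proof.
move=> dlt0.
have /cvgrPdist_le/(_ _ dlt0)[n0 _ H] : rho ^+ n @[n --> \oo] --> (0 : R).
  by apply: cvg_expr; rewrite ger0_norm// ltW.
exists n0 => n /H; rewrite /= sub0r normrN ger0_norm// exprn_ge0// ltW//.
Qed.

(* [heat k . o] varies slowly, as its gradient is bounded by the energy; since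
   its sum over the vertices is 1, its value at [o] is small. *)
Let return_prob_small (dlt : R) n : 0 < dlt ->
  exists2 m, (n <= m)%N & return_prob (m + m) <= dlt.
Proof.
move=> dlt0; pose N := (Num.bound (2 / dlt)).+1.
have N0 : 0 < N%:R :> R by rewrite ltr0n.
have Ndlt : 2 <= N%:R * dlt.
  have /archi_boundP : 0 <= 2 / dlt by rewrite divr_ge0// ltW.
  by rewrite ltr_pdivrMr// /N -natr1; nra.
have [s us sN] := V_infinite N.
have [r rs] : exists r, {subset s <= ball r o}.
  elim: s {us sN} => [|x s [r rs]]; first by exists 0.
  have [k xk] := connected x; exists (maxn r k) => y.
  rewrite inE => /predU1P[->|/rs]; first exact: ball_le (leq_maxr _ _) _ xk.
  by apply: ball_le; rewrite leq_maxl.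
(* Chosen so that [N * (r * c) <= 1]: summing [f x >= f o - r * c] over [s] then gives
   [N * f o <= 2 <= N * dlt]. *)
pose c : R := (r.+1%:R * N%:R)^-1.
have c0 : 0 < c by rewrite invr_gt0 mulr_gt0 ?ltr0n.
have [n0 H] := exp_small
  (divr_gt0 (exprn_gt0 2 c0) (mulr_gt0 (ltr0n _ 4) dR_gt0)).
pose m := maxn n n0; exists m; first by rewrite leq_maxl.
pose k := (m + m)%N; pose f x := heat k x o.
have f_lip u w : w \in nbrs u -> `|f u - f w| <= c.
  move=> wu; rewrite -(ler_pXn2r (ltn0Sn 1)) ?nnegrE ?(ltW c0)//.
  rewrite real_normK ?num_real//.
  pose B := undup (o :: ball k u ++ ball k w).
  have -> : c ^+ 2 = 4 * d%:R * (c ^+ 2 / (4 * d%:R)) by field.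
  apply: (@le_trans _ _ (dist2 k u w)); last first.
    rewrite (le_trans (dist2_le _ wu))// ler_wpM2l ?mulr_ge0 ?ler0n//.
    rewrite (le_trans (energy_decay _))// H// /k (leq_trans (leq_maxr n n0))//.
    exact: leq_addr.
  (* The squared gradient is the single term at [o] of this sum. *)
  rewrite -(@dist2E k u w B) ?undup_uniq//; last 2 first.
  - by move=> y yb; rewrite mem_undup inE mem_cat yb orbT.
  - by move=> y yb; rewrite mem_undup inE mem_cat yb !orbT.
  rewrite (bigD1_seq o) ?undup_uniq ?mem_undup ?mem_head//= lerDl.
  by rewrite sumr_ge0// => y _; rewrite sqr_ge0.
have f_sum : \sum_(x <- s) f x <= 1.
  have -> : \sum_(x <- s) f x = \sum_(x <- s) 1 * iter k walk (delta x) o.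
    by apply: eq_bigr => x _; rewrite mul1r.
  rewrite -(iter_walk_sum k s (fun=> 1)).
  rewrite -[leRHS](iter_walk_cst k 1 o); apply: iter_walk_le => y.
  have [ys|ys] := boolP (y \in s).
    rewrite (bigD1_seq y)//= /delta eqxx mul1r big1 ?addr0// => x /negbTE ->.
    by rewrite mulr0.
  rewrite big_seq big1 ?ler01// => x xs; rewrite /delta.
  by case: eqVneq => [xy|_]; [rewrite -xy xs in ys|rewrite mulr0].
have f_o : \sum_(x <- s) (f o - r%:R * c) <= \sum_(x <- s) f x.
  rewrite big_seq [leRHS]big_seq ler_sum// => x /rs xr.
  have := ball_lipschitz (ltW c0) f_lip xr; rewrite ler_norml; lra.
have Nrc : N%:R * (r%:R * c) <= 1.
  have -> : N%:R * (r%:R * c) = r%:R / r.+1%:R :> R.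
    by rewrite /c; field; rewrite nat1r !pnatr_eq0.
  by rewrite ler_pdivrMr ?ltr0n// mul1r ler_nat.
move: f_o; rewrite big_const_seq count_predT sN iter_addr_0.
rewrite -(mulr_natl (_ - _)).
rewrite -[return_prob k]/(f o) => f_o.
have : N%:R * f o <= N%:R * dlt by move: f_o; rewrite mulrBr; lra.
by rewrite ler_pM2l.
Qed.

(** The return probability loses at most [2 * rho ^+ k] between times [2k] and [2k + 2], and
    [2 / eps * rho ^+ k] is the tail of this geometric series. Hence [u] is nondecreasing, while
    [return_prob_small] gives it arbitrarily small upper bounds at late times, so [u n <= 0]. *)
Lemma return_prob_decay n : return_prob (n + n) <= 2 / eps * (1 - eps) ^+ n.
Proof.
rewrite -/rho; pose u k := return_prob (k + k) - 2 / eps * rho ^+ k.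
have uS k : u k <= u k.+1.
  have drop_ge0 := energy_drop_ge0 k.
  have : return_prob (k + k) - return_prob (k.+1 + k.+1) <= 2 * rho ^+ k.
    have := energy_decay k; move: drop_ge0.
    by rewrite /energy_drop /energy addSn addnS; lra.
  have -> : 2 * rho ^+ k = 2 / eps * rho ^+ k - 2 / eps * rho ^+ k.+1.
    by rewrite exprS /rho; field; rewrite gt_eqF.
  by rewrite /u; lra.
have u_le k : u n <= u (n + k)%N.
  by elim: k => [|k IH]; [rewrite addn0|rewrite addnS (le_trans IH)].
rewrite -subr_le0 -/(u n); apply/ler_addgt0Pr => dlt dlt0; rewrite add0r.
have [m nm mdlt] := return_prob_small n dlt0.
have := u_le (m - n)%N; rewrite subnKC// => /le_trans; apply.
rewrite (le_trans _ mdlt)// /u gerBl mulr_ge0 ?divr_ge0 ?(ltW eps_gt0)//.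
by rewrite exprn_ge0// ltW.
Qed.

End EnergyDecay.

(** ** Entropy *)

(** Minus the sum of [p ln p] over [p = heat n o y], by [sum_heat]; points outside [ball n o] have
    no influence. *)
Definition entropy n : R := - iter n walk (fun y => ln (heat n o y)) o.

Lemma entropyE n x : entropy n = - iter n walk (fun y => ln (heat n x y)) x.
Proof.
have [phi [inj <- aut]] := nbrs_trans o x; rewrite -iter_walk_aut//.
by congr (- iter _ _ _ _); apply/funext => y; rewrite /= heat_aut.
Qed.

(** From [ln t <= t - 1] at [t = p / q]; the factor [p] takes care of [p = 0], where [ln] has a
    default value. *)
Lemma mul_ln_le (p q : R) : 0 <= p -> 0 < q ->
  p * (ln p - ln q) <= p * ((p - q) / q).
Proof.
rewrite le_eqVlt => /predU1P[<-|p0 q0]; first by rewrite !mul0r.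
rewrite ler_pM2l// -ln_div ?posrE//.
have pq0 : 0 < p / q by rewrite divr_gt0.
rewrite mulrBl divff ?gt_eqF//.
have := @le_ln1Dx R (p / q - 1); rewrite [1 + _]addrC subrK; apply.
by rewrite ltrBDr addNr.
Qed.

(** Jensen's inequality for [ln], as the squares of [heat n o] sum to [return_prob (n + n)].
    Concretely, [mul_ln_le] is applied with [q] this sum, and the right-hand sides add up to 0. *)
Lemma entropy_ge n : - ln (return_prob (n + n)) <= entropy n.
Proof.
rewrite /entropy lerN2; set a := return_prob _.
have a0 : 0 < a by exact: heat_diag_gt0.
pose B := undup (ball n o).
have uB : uniq B by exact: undup_uniq.
have oB : {subset ball n o <= B} by move=> y; rewrite mem_undup.
rewrite -(iter_walk_cst n (ln a) o) -!(sum_heat _ uB oB) -subr_le0 -sumrB.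
have : \sum_(y <- B) heat n o y * ((heat n o y - a) / a) = 0.
  have -> : \sum_(y <- B) heat n o y * ((heat n o y - a) / a) =
            (\sum_(y <- B) heat n o y * heat n o y) / a -
            \sum_(y <- B) heat n o y.
    by rewrite mulr_suml -sumrB; apply: eq_bigr => y _; field; rewrite gt_eqF.
  by rewrite sum_heatM// sum_heat1// divff ?gt_eqF// subrr.
move=> sum0; rewrite -[leRHS]sum0; apply: ler_sum => y _.
by rewrite -mulrBr mul_ln_le// heat_ge0.
Qed.

Lemma ball_trans m n x y : x \in ball m o -> y \in ball n x ->
  y \in ball (n + m) o.
Proof.
move=> xo; elim: n y => [y|n IH y]; first by rewrite inE => /eqP ->.
by move=> /flatten_mapP[v /IH vo yv]; exact: ballS vo yv.
Qed.

(** Conditioning on the first step [x], the increment is the mean of the relative entropies [D x] of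
    [heat n x] with respect to [heat n.+1 o]. By [mul_ln_le] these are at most l^1 distances times a
    bound on the ratio of the densities, which [le_heatS] provides. *)
Lemma entropyS_le n (c : R) :
  (forall x, x \in o :: nbrs o ->
    \sum_(y <- undup (ball n.+1 o)) `|heat n x y - heat n.+1 o y| <= c) ->
  entropy n.+1 - entropy n <= 2 * d%:R * c.
Proof.
move=> Hc; 
pose D x :=
  iter n walk (fun y => ln (heat n x y) - ln (heat n.+1 o y)) x.
have -> : entropy n.+1 - entropy n = walk D o.
  have -> : D = fun x =>
      - 1 * iter n walk (fun y => ln (heat n.+1 o y)) x + - entropy n.
    by apply/funext => x; rewrite /D iter_walkB (entropyE n x); ring.
  by rewrite walk_lin walk_cst /entropy /=; ring.
rewrite -(walk_cst (2 * d%:R * c) o); apply: walk_le => x xo.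
have uB : uniq (undup (ball n.+1 o)) by exact: undup_uniq.
have xB : {subset ball n x <= undup (ball n.+1 o)}.
  move=> y yx; rewrite mem_undup -addn1; apply: ball_trans yx.
  by rewrite /= cats0.
rewrite /D -(sum_heat _ uB xB).
apply: le_trans (ler_wpM2l _ (Hc _ xo)); last by rewrite mulr_ge0 ?ler0n.
rewrite mulr_sumr; apply: ler_sum => y _.
have p_ge0 := heat_ge0 n x y; have pq := le_heatS n y xo.
(* Where the second density vanishes so does the first, and the default value of [ln] is multiplied
   by 0. *)
have [q0|q0] := leP (heat n.+1 o y) 0.
  have p0 : heat n x y = 0.
    apply/le_anti; rewrite p_ge0 andbT (le_trans pq)//.
    by rewrite mulr_ge0_le0 ?mulr_ge0 ?ler0n.
  by rewrite p0 mul0r !mulr_ge0 ?ler0n.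
apply: le_trans (mul_ln_le p_ge0 q0) _.
have -> : heat n x y * ((heat n x y - heat n.+1 o y) / heat n.+1 o y) =
          heat n x y / heat n.+1 o y * (heat n x y - heat n.+1 o y) by ring.
have r0 : 0 <= heat n x y / heat n.+1 o y by rewrite divr_ge0// ltW.
rewrite (le_trans (ler_wpM2l r0 (ler_norm _)))// ler_wpM2r//.
by rewrite ler_pdivrMr.
Qed.

(** Otherwise the entropy would grow by at most [kappa / 2] per step from [l0] on, against a linear
    lower bound of slope [kappa]. *)
Lemma heat_separation (kappa C : R) : 0 < kappa ->
  (forall n, kappa * n%:R - C <= entropy n) ->
  forall l0, exists2 l, (l0 <= l)%N & exists2 x, x \in o :: nbrs o &
    kappa / (4 * d%:R) <=
    \sum_(y <- undup (ball l.+1 o)) `|heat l x y - heat l.+1 o y|.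
Proof.
move=> kappa0 Hent l0; apply: contrapT => H.
have inc l : (l0 <= l)%N -> entropy l.+1 - entropy l <= kappa / 2.
  move=> l0l; have -> : kappa / 2 = 2 * d%:R * (kappa / (4 * d%:R)) by field.
  apply: entropyS_le => x xo; rewrite leNgt; apply/negP => /ltW lt.
  by apply: H; exists l => //; exists x.
have ent_le k : entropy (l0 + k) <= entropy l0 + k%:R * (kappa / 2).
  elim: k => [|k IH]; first by rewrite addn0 mul0r addr0.
  by have := inc _ (leq_addr k l0); rewrite addnS -[k.+1%:R]natr1; lra.
pose b := Num.max 0 (entropy l0 + C).
have b0 : 0 <= b by rewrite le_max lexx.
have bC : entropy l0 + C <= b by rewrite le_max lexx orbT.
pose k := Num.bound (b / (kappa / 2)).
have /archi_boundP : 0 <= b / (kappa / 2) by rewrite !divr_ge0// ltW.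
rewrite -/k ltr_pdivrMr ?divr_gt0// => bk.
have := Hent (l0 + k)%N; have := ent_le k; rewrite natrD.
have : 0 <= kappa * l0%:R by rewrite mulr_ge0 ?ler0n// ltW.
lra.
Qed.

Lemma almost_harmonic_separation (delta eps : R) : 0 < delta -> 0 < eps ->
  (forall l0, exists2 l, (l0 <= l)%N & exists2 x, x \in o :: nbrs o &
    delta <= \sum_(y <- undup (ball l.+1 o)) `|heat l x y - heat l.+1 o y|) ->
  exists f, almost_harmonic eps (delta ^+ 2 / 16) f.
Proof.
(* The bound [delta / 2] serves to replace [walk f o] by [f o]; the other two give
   [eps1 ^+ 2 <= eps]. *)
move=> delta0 eps0 sep; pose eps1 := Num.min (delta / 2) (Num.min eps 1).
have eps1_gt0 : 0 < eps1 by rewrite !lt_min eps0 ltr01 divr_gt0.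
have [eps1d eps1e eps11] : [/\ eps1 <= delta / 2, eps1 <= eps & eps1 <= 1].
  by rewrite /eps1 !ge_min !lexx !orbT.
have [l0 Hl0] := iter_walk_step eps1_gt0.
have [l l0l [x xo deltale]] := sep l0.
pose g y := Num.sg (heat l x y - heat l.+1 o y).
have g1 y : `|g y| <= 1 by rewrite normr_sg; case: (_ != _).
pose f := iter l walk g; have f1 y : `|f y| <= 1 by exact: iter_walk_norm.
have f_step y : `|f y - walk f y| <= eps1 by exact: Hl0.
have fx : delta <= f x - walk f o.
  apply: le_trans deltale _.
  have uB : uniq (undup (ball l.+1 o)) by exact: undup_uniq.
  have oB : {subset ball l.+1 o <= undup (ball l.+1 o)}.
    by move=> y; rewrite mem_undup.
  have xB : {subset ball l x <= undup (ball l.+1 o)}.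
    move=> y yx; rewrite mem_undup -addn1; apply: ball_trans yx.
    by rewrite /= cats0.
  rewrite -[walk f o]/(iter l.+1 walk g o) -(sum_heat _ uB oB).
  rewrite /f -(sum_heat _ uB xB) -sumrB ler_sum// => y _.
  by rewrite -mulrBl mulrC -normrEsg.
have fxo : delta / 2 <= f x - f o.
  by have := f_step o; rewrite ler_norml => /andP[]; lra.
(* As [f] is bounded by 1, its differences are at most 2; and [delta ^+ 2 / 16 * 4] is the square of
   [delta / 2]. *)
exists f, 4 => //; split=> [u w _|u|].
- have := f1 u; have := f1 w; rewrite !ler_norml => /andP[? ?] /andP[? ?].
  by nra.
- have := f_step u; rewrite ler_norml => /andP[? ?].
  by apply: (@le_trans _ _ (eps1 ^+ 2)); nra.
exists x; last by nra.
move: xo; rewrite inE => /predU1P[xo|//]; move: fxo; rewrite xo subrr; lra.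
Qed.

Lemma exists_almost_harmonic :
  exists2 c : R, 0 < c &
    forall eps : R, 0 < eps -> exists f, almost_harmonic eps c f.
Proof.
have [energyP|] := pselect (forall eps : R, 0 < eps ->
    exists2 n, 0 < energy n & energy_drop n <= eps * energy n).
  exists d%:R^-1; first by rewrite invr_gt0.
  move=> eps eps0; have [n E0 dropE] := energyP _ eps0.
  exact: almost_harmonic_energy dropE.
move=> /existsNP[eps0 /not_implyP[eps0_gt0 dropN]].
(* The cap at one half keeps [1 - eps] positive, so that its logarithm makes sense. *)
pose eps := Num.min eps0 2^-1.
have eps_gt0 : 0 < eps by rewrite lt_min eps0_gt0 invr_gt0 ltr0n.
have eps_lt1 : eps < 1 by rewrite gt_min invf_lt1 ?ltr1n ?orbT.
have dropE n : eps * energy n <= energy_drop n.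
  have [E0|E0] := ltP 0 (energy n); last first.
    by rewrite (le_trans _ (energy_drop_ge0 n))// mulr_ge0_le0// ltW.
  apply: (@le_trans _ _ (eps0 * energy n)).
    by rewrite ler_wpM2r ?ge_min ?lexx// ltW.
  rewrite leNgt; apply/negP => /ltW lt; apply: dropN; exists n => //.
have rho_gt0 : 0 < 1 - eps by rewrite subr_gt0.
have K_gt0 : 0 < 2 / eps by rewrite divr_gt0.
pose kappa := - ln (1 - eps).
have kappa_gt0 : 0 < kappa by rewrite oppr_gt0 ln_lt0// rho_gt0 gtrBl.
have entropy_lin n : kappa * n%:R - ln (2 / eps) <= entropy n.
  apply: le_trans (entropy_ge n).
  have := return_prob_decay eps_gt0 eps_lt1 dropE n.
  have a_gt0 : 0 < return_prob (n + n) by exact: heat_diag_gt0.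
  rewrite -ler_ln ?posrE ?(mulr_gt0 K_gt0) ?exprn_gt0//.
  rewrite lnM ?posrE ?exprn_gt0// lnXn// -(mulr_natr (ln _)) /kappa.
  by lra.
have sep := heat_separation kappa_gt0 entropy_lin.
have delta_gt0 : 0 < kappa / (4 * d%:R) by rewrite divr_gt0// mulr_gt0.
exists ((kappa / (4 * d%:R)) ^+ 2 / 16); first by rewrite divr_gt0// exprn_gt0.
by move=> eps' eps'0; exact: almost_harmonic_separation sep.
Qed.

(** ** Passage to the limit *)

(** Along one ultrafilter the limits at all vertices exist simultaneously, which replaces a diagonal
    extraction. *)
Lemma bounded_ultra_cvg (U : set_system nat) (u : nat -> R) (c : R) :
  UltraFilter U -> (forall n, `|u n| <= c) -> exists l : R, u @ U --> l.
Proof.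
move=> UU uc; have Uc : (u @ U) `[- c, c]%classic.
  rewrite /fmap/=; apply: filterE => n.
  by rewrite /= in_itv/= -ler_norml; exact: uc.
have [l [_ clu]] := @segment_compact R (- c) c _ _ Uc.
exists l => A lA; have [//|UA] := in_ultra_setVsetC (u @^-1` A) UU.
by have [x [/= NAx Ax]] := clu (~` A) A UA lA.
Qed.

Lemma harmonic_limit (c : R) : 0 < c ->
  (forall eps : R, 0 < eps -> exists f, almost_harmonic eps c f) ->
  exists f, [/\ forall x z, z \in nbrs x -> `|f x - f z| <= 1,
                forall x, avg f x = f x & exists x, f x != f o].
Proof.
move=> c0 H.
(* Dividing by [Num.sqrt A] and subtracting the value at [o] normalises [f]. The neighbour with the
   large gradient may vary with [n], so the lower bound is put on a sum over all neighbours of [o],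
   which passes to the limit. *)
have {}H n : exists f : V -> R, [/\ f o = 0,
    forall x z, z \in nbrs x -> `|f x - f z| <= 1,
    forall x, (f x - walk f x) ^+ 2 <= n.+1%:R^-1
    & c <= \sum_(x <- nbrs o) f x ^+ 2].
  have [|f [A A0 [f_lip f_harm [x xo fx]]]] := H n.+1%:R^-1.
    by rewrite invr_gt0 ltr0n.
  pose a := (Num.sqrt A)^-1.
  have a2 : a ^+ 2 = A^-1 by rewrite exprVn sqr_sqrtr ?ltW.
  have aA (t b : R) : t ^+ 2 <= b * A -> (a * t) ^+ 2 <= b.
    by move=> tb; rewrite exprMn a2 mulrC ler_pdivrMr.
  exists (fun x => a * f x + - (a * f o)); split => [|u w wu|u|].
  - by rewrite subrr.
  - rewrite -(ler_pXn2r (ltn0Sn 1)) ?nnegrE// real_normK ?num_real// expr1n.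
    have -> : a * f u - a * f o - (a * f w - a * f o) = a * (f u - f w) by ring.
    by apply: aA; rewrite mul1r f_lip.
  - rewrite walk_lin walk_cst.
    have -> : a * f u - a * f o - (a * walk f u - a * f o) =
              a * (f u - walk f u) by ring.
    exact: aA.
  - rewrite (bigD1_seq x)//= ler_wpDr ?sumr_ge0// => [w _|].
      exact: sqr_ge0.
    rewrite -mulrBr exprMn a2 mulrC ler_pdivlMr//.
have {H}[F HF] := choice H.
have [U [UU subU]] := ultraFilterLemma (@eventually_filter).
have /choice[f Ff] x : exists l : R, F ^~ x @ U --> l.
  have [r xr] := connected x; apply: (@bounded_ultra_cvg _ _ r%:R) => n.
  have [Fo F_lip _ _] := HF n.
  by have := ball_lipschitz ler01 F_lip xr; rewrite Fo subr0 mulr1.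
have F_avg x : avg (F n) x @[n --> U] --> avg f x.
  apply: cvgMr_tmp.
  exact: (@cvg_big _ _ _ _ xpredT add_continuous _ U _ (fun w n => F n w) f).
have F_walk x : walk (F n) x @[n --> U] --> walk f x.
  by apply: cvgMr_tmp; apply: cvgD.
exists f; split => [x z zx|x|].
- apply: (@cvgr_to_le _ U _ _ (fun n => `|F n x - F n z|)).
    by apply: cvg_norm; apply: cvgB; exact: Ff.
  by apply: filterE => n; have [_ + _ _] := HF n; apply.
- suff : f x - walk f x = 0 by rewrite /walk; lra.
  apply/eqP; rewrite -sqrf_eq0 eq_le sqr_ge0 andbT.
  (* Here [harmonic] is the sequence of the [n.+1%:R^-1], which tends to 0. *)
  apply: (@ler_cvg_to _ U _ _ (fun n => (F n x - walk (F n) x) ^+ 2) harmonic).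
  + have sub : F n x - walk (F n) x @[n --> U] --> f x - walk f x.
      exact: cvgB.
    by apply: (cvgM sub sub).
  + by move=> A /cvg_harmonic; exact: subU.
  + by apply: filterE => n; have [_ _ + _] := HF n; apply.
apply: contrapT => /forallNP f_cst.
have : c <= \sum_(x <- nbrs o) f x ^+ 2.
  apply: (@cvgr_to_ge _ U _ _ (fun n => \sum_(x <- nbrs o) F n x ^+ 2)).
    apply: (@cvg_big _ _ _ _ xpredT add_continuous _ U _
      (fun w n => F n w ^+ 2) (fun w => f w ^+ 2)) => x _.
    exact: (cvgM (Ff x) (Ff x)).
  by apply: filterE => n; have [_ _ _] := HF n.
have fo : f o = 0.
  apply/le_anti/andP; split.
    apply: (@cvgr_to_le _ U _ _ _ _ _ (Ff o)); apply: filterE => n.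
    by have [-> _ _ _] := HF n.
  apply: (@cvgr_to_ge _ U _ _ _ _ _ (Ff o)); apply: filterE => n.
  by have [-> _ _ _] := HF n.
rewrite big1 => [|x _]; first by rewrite leNgt c0.
by have /negP := f_cst x; rewrite negbK => /eqP ->; rewrite fo expr0n.
Qed.

End RegularGraph.

(** * From a transitive graph to its neighbour lists, and the disconnected case *)

Section LipschitzHarmonic.
Variables (R : realType) (V : choiceType) (G : graph V).
Hypothesis V_infinite : infinite_set [set: V].
Hypothesis G_locally_finite : locally_finite G.
Hypothesis G_transitive : vertex_transitive G.

Let nbrs v : seq V := enum_fset (fset_set (neighbors G v)).

Let nbrsP v w : reflect (adj G v w) (w \in nbrs v).
Proof.
have -> : (w \in nbrs v) = (w \in neighbors G v).
  by rewrite -(in_fset_set (G_locally_finite v)).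
by apply: (iffP idP) => [/set_mem|vw]; [|exact: mem_set].
Qed.

Let nbrs_uniq v : uniq (nbrs v). Proof. exact: fset_uniq. Qed.

Let nbrs_sym v w : (w \in nbrs v) = (v \in nbrs w).
Proof. by apply/nbrsP/nbrsP => /adj_sym. Qed.

Let nbrs_trans v w : exists phi : V -> V,
  [/\ injective phi, phi v = w &
      forall u, perm_eq (map phi (nbrs u)) (nbrs (phi u))].
Proof.
have [phi [[psi phiK psiK] adj_phi] phiv] := G_transitive v w.
exists phi; split => // [|u]; first exact: can_inj phiK.
apply: uniq_perm => // [|z].
  by rewrite map_inj_uniq//; exact: can_inj phiK.
apply/mapP/nbrsP => [[y /nbrsP uy ->]|]; first exact/adj_phi.
rewrite -{1}(psiK z) => /adj_phi uz.
by exists (psi z); [exact/nbrsP|rewrite psiK].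
Qed.

Let size_nbrs v w : size (nbrs v) = size (nbrs w).
Proof.
by have [phi [_ <- /(_ v)/perm_size]] := nbrs_trans v w; rewrite size_map.
Qed.

Lemma exists_nonconstant_harmonic : exists f : V -> R,
  [/\ exists x y, f x != f y,
      forall v, \sum_(w <- nbrs v) (f v - f w) = 0
    & forall v w, adj G v w -> `|f v - f w| <= 1].
Proof.
have /set0P[ o _] : [set: V] != set0.
  by apply/eqP => V0; apply: V_infinite; rewrite V0.
have [conn|] := pselect (forall x, exists n, x \in ball nbrs n o); last first.
  (* The indicator function of a connected component. *)
  move=> /existsNP[x xN].
  pose f v : R := `[< exists n, v \in ball nbrs n o >]%:R.
  have f_adj v w : adj G v w -> f v = f w.
    have step u u' : adj G u u' -> (exists n, u \in ball nbrs n o) ->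
        exists n, u' \in ball nbrs n o.
      move=> uu' [n un]; exists n.+1; apply: ballS un _.
      by rewrite inE; apply/orP; right; apply/nbrsP.
    move=> vw; congr (_%:R); congr nat_of_bool; apply/asbool_equiv_eq.
    by split; apply: step => //; exact: adj_sym.
  exists f; split.
  - exists o, x; rewrite /f asboolT; last by exists 0; rewrite mem_head.
    by rewrite asboolF// oner_eq0.
  - by move=> v; rewrite big_seq big1// => w /nbrsP/f_adj ->; rewrite subrr.
  - by move=> v w /f_adj ->; rewrite subrr normr0 ler01.
have V_inf n : exists2 s : seq V, uniq s & size s = n.
  have [B _ nB] := infinite_set_fset n V_infinite.
  exists (take n B); first by rewrite take_uniq// fset_uniq.
  by rewrite size_takel// cardfE.
(* In degree 0 all balls reduce to [o], so a connected graph could not have two vertices. *)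
have d_gt0 : (0 < size (nbrs o))%N.
  rewrite lt0n; apply/negP => /eqP d0.
  have ball_o n x : x \in ball nbrs n o -> x = o.
    elim: n x => [|n IH] x; first by rewrite inE => /eqP.
    move=> /flatten_mapP[v /IH ->]; rewrite (size0nil d0) inE => /eqP //.
  have [[|x [|y s]] //= us _] := V_inf 2.
  have [n /ball_o xo] := conn x; have [m /ball_o yo] := conn y.
  by move: us; rewrite xo yo !inE eqxx.
have size_o v : size (nbrs v) = size (nbrs o) by exact: size_nbrs.
have [c c0 Hc] := @exists_almost_harmonic R V nbrs (size (nbrs o)) d_gt0
  nbrs_uniq nbrs_sym size_o nbrs_trans o conn V_inf.
have [f [f_lip f_avg [x fx]]] :=
  harmonic_limit d_gt0 nbrs_uniq size_o conn c0 Hc.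
exists f; split; first by exists x, o.
- move=> v; rewrite sumrB big_const_seq count_predT size_o iter_addr_0.
  rewrite -(f_avg v) /avg -(mulr_natr (_ / _)) divfK ?subrr//.
  by rewrite pnatr_eq0 -lt0n.
- by move=> v w /nbrsP; exact: f_lip.
Qed.

End LipschitzHarmonic.

Theorem theorem1p1 (R : realType) (V : choiceType) (G : graph V)
  (V_infinite : infinite_set [set: V])
  (G_locally_finite : locally_finite G)
  (G_transitive : vertex_transitive G) :
  exists f : V -> R[i],
    [/\ ~ (exists c : R[i], forall v, f v = c),
        graph_harmonic G f
      & graph_Lipschitz G f].
Proof.
have [f [[x [y fxy]] f_harm f_lip]] :=
  exists_nonconstant_harmonic R V_infinite G_locally_finite G_transitive.
exists (fun v => (f v)%:C%C); split.
- move=> [c fc]; move/eqP: fxy; apply.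
  by have := fc x; rewrite -(fc y) => -[].
(* By local finiteness the sum over a set is the sum over the neighbour list, and the embedding of
   the reals commutes with it. *)
- move=> v; rewrite /laplacian fsbig_finite; last exact: G_locally_finite.
  rewrite (eq_bigr (fun w => (f v - f w)%:C%C)); last first.
    by move=> w _; rewrite rmorphB.
  by rewrite -(rmorph_sum (real_complex R)) f_harm rmorph0.
- exists 1 => _ [[v w] /= vw <-]; rewrite /= subrr expr0n addr0 sqrtr_sqr.
  exact: f_lip.
Qed.
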